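(* Let $M\ge 1$ and let $(X_i,Y)\sim p_i(X,Y)$, $1\le i\le M$, be $M$ source domains with pairwise distinct joint distributions $p_i$ of input and class label. Let $f$ be a feature extractor and put $Z_i=f(X_i)$ for $1\le i\le M$. Suppose the features are domain-invariant across the $M$ source domains, i.e. the joint distributions of features and label coincide: $p(Z_1,Y)=\cdots=p(Z_M,Y)$. Then $$\inf_{g}\sum_{i=1}^{M}\mathbb{E}_{p_i}\big[\ell_{CE}(g(Z_i),Y)\big]-\inf_{h}\sum_{i=1}^{M}\mathbb{E}_{p_i}\big[\ell_{CE}(h(X_i),Y)\big]\ \ge\ \Delta_p,$$ where $\Delta_p:=\sum_{i\neq m^*}\big(I(X_i;Y)-I(X_{m^*};Y)\big)$ and $m^*$ is an index with $I(X_{m^*};Y)=\min\{I(X_1;Y),\dots,I(X_M;Y)\}$.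
   Context: $X$ denotes the input variable and $Y$ the (finite-valued) class label; in domain $i$ the pair is distributed as $p_i$, and $X_i$ denotes the input of domain $i$. A feature extractor $f:X\to Z$ is a map from inputs to a feature space; the same $f$ is used in all domains. $g$ ranges over predictive functions from the feature space to label predictions (probability vectors over the classes), and $h$ ranges over predictive functions from the input space to label predictions. $\ell_{CE}$ is the cross-entropy loss, $\ell_{CE}(q,y)=-\log q_y$. $I(X_i;Y)$ is the mutual information of $X_i$ and $Y$ computed under $p_i$. The relation between conditional entropy and cross-entropy loss used as a convention is the variational form $H(Y|X)=\inf_h\mathbb{E}_p[\ell_{CE}(h(X),Y)]$. The quantity $\Delta_p$ is called the information gap of the source domains.
   Formalization: The second infimum is taken over families (h_i), one predictor per source domain, so it equals the sum of the H(Y|X_i); with a single h shared by all domains the inequality is false (X_1=Y uniform bit; X_2, Y independent uniform bits; f constant). *)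

(* Defs.v *)
From HB Require Import structures.
From mathcomp Require Import all_boot all_order all_algebra.
From mathcomp Require Import all_classical all_reals all_analysis.

Set Implicit Arguments.
Unset Strict Implicit.
Unset Printing Implicit Defensive.

Import Order.TTheory GRing.Theory Num.Theory.
Import numFieldNormedType.Exports.

Local Open Scope classical_set_scope.
Local Open Scope ring_scope.

(* The K + 1 class labels, with the discrete sigma-algebra. *)
Definition label (K : nat) : Type := 'I_K.+1.

HB.instance Definition _ (K : nat) := Finite.on (label K).
HB.instance Definition _ (K : nat) := isPointed.Build (label K) (ord0 : 'I_K.+1).
HB.instance Definition _ (K : nat) :=
  @isMeasurable.Build default_measure_display (label K) discrete_measurable
    discrete_measurable0 discrete_measurableC discrete_measurableU.

HB.instance Definition _ d1 d2 (T1 : measurableType d1)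
    (T2 : measurableType d2) :=
  isMeasurableFun.Build _ _ _ _ (@fst T1 T2) measurable_fst.
HB.instance Definition _ d1 d2 (T1 : measurableType d1)
    (T2 : measurableType d2) :=
  isMeasurableFun.Build _ _ _ _ (@snd T1 T2) measurable_snd.

Section predictors.
Context {R : realType} {K : nat}.

Definition predictor {d} (T : measurableType d) : set (T -> label K -> R) :=
  [set h : T -> label K -> R |
    [/\ forall y, measurable_fun [set: T] (h ^~ y),
        forall x y, 0 <= h x y &
        forall x, \sum_y h x y = 1]].

Local Open Scope ereal_scope.

(* Takes the value +oo when q y = 0. *)
Definition cross_entropy (q : label K -> R) (y : label K) : \bar R :=
  - lne (q y)%:E.

Definition expected_CE {d} {T : measurableType d}
    (p : probability (T * label K)%type R) (h : T -> label K -> R) : \bar R :=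
  \int[p]_w cross_entropy (h w.1) w.2.

End predictors.

Arguments predictor {R K d} T _.

Section information.
Context {R : realType}.
Local Open Scope ereal_scope.
Local Open Scope charge_scope.

Definition KL_divergence {d} {T : measurableType d} (P Q : probability T R) :
    \bar R :=
  if `[< P `<< Q >]
  then \int[P]_w lne (('d (charge_of_finite_measure P) '/d Q) w)
  else +oo.

Definition mutual_information {d1 d2} {T1 : measurableType d1}
    {T2 : measurableType d2} (p : probability (T1 * T2)%type R) : \bar R :=
  KL_divergence p (distribution p fst \x distribution p snd).

(* m is meant to be an index minimizing mutual_information (p m). *)
Definition information_gap {d1 d2} {T1 : measurableType d1}
    {T2 : measurableType d2} {M : nat}
    (p : 'I_M -> probability (T1 * T2)%type R) (m : 'I_M) : \bar R :=
  \sum_(i < M | i != m) (mutual_information (p i) - mutual_information (p m)).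

End information.

Section optimal_risks.
Context {R : realType} {K M : nat} {dX : measure_display}
  {X : measurableType dX}.
Variable p : 'I_M -> probability (X * label K)%type R.
Local Open Scope ereal_scope.

Definition optimal_feature_CE {dZ} {Z : measurableType dZ} (f : X -> Z) :
    \bar R :=
  ereal_inf [set \sum_(i < M) expected_CE (p i) (g \o f)
            | g in predictor Z].

(* The predictor is applied to the input X_i of domain i and may depend on i,
   so that this infimum is the sum over i of the conditional entropies
   H(Y|X_i) = inf_h E_{p_i}[l_CE(h(X_i), Y)].  An infimum over a single h for
   all domains would instead be the conditional entropy under the mixture of
   the p_i (times M), which can be strictly larger than that sum. *)
Definition optimal_input_CE : \bar R :=
  ereal_inf [set \sum_(i < M) expected_CE (p i) (h i)
            | h in [set h : 'I_M -> X -> label K -> R | forall i, h i \in predictor X]].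

End optimal_risks.

(* Main.v *)
(* For one domain with joint law p, input marginal mu and label marginal pi,
   the posterior [pi y * dp/d(mu x pi) (x, y)] disintegrates p over mu.  By
   Gibbs' inequality it minimizes the expected cross-entropy among predictors
   of the input, and taking logarithms of the Radon-Nikodym derivative gives
   I(X; Y) = H(Y) - H(Y | X), all terms being finite.  Invariance of the law of
   (f(X_i), Y) makes both H(Y) and the risk of any g o f independent of i; the
   latter is then at least H(Y | X_m), so the left side of the inequality is at
   least the sum over i of H(Y | X_m) - H(Y | X_i) = I(X_i; Y) - I(X_m; Y). *)
Require Import Defs.
From HB Require Import structures.
From mathcomp Require Import all_boot all_order all_algebra.
From mathcomp Require Import ring.
From mathcomp Require Import all_classical all_reals all_analysis.
From mathcomp Require Import measurable_realfun.

Set Implicit Arguments.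
Unset Strict Implicit.
Unset Printing Implicit Defensive.

Import Order.TTheory GRing.Theory Num.Theory.
Import numFieldNormedType.Exports.

Local Open Scope classical_set_scope.
Local Open Scope ring_scope.

(** * Measurability and integration over the finite label space *)

Section label_measurability.
Context {K : nat}.

(** Labels are finitely many, so the preimage of a measurable set is a finite union of rectangles
    carrying one label each. *)
Lemma measurable_fun_label d (T : measurableType d) d' (T' : measurableType d')
    (F : T * label K -> T') :
  (forall y, measurable_fun [set: T] (fun x => F (x, y))) ->
  measurable_fun [set: T * label K] F.
Proof.
move=> mF _ B mB; rewrite setTI.
have -> : F @^-1` B = \bigcup_(y in [set: label K])
    (((fun x => F (x, y)) @^-1` B) `*` [set y]).
  apply/seteqP; split => [[x y] /= Bxy|[x y] [z _ [/= Bxz ->]]] //.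
  by exists y.
apply: fin_bigcup_measurable; first exact: finite_finset.
move=> y _; apply: measurableX => //.
by rewrite -[X in measurable X]setTI; exact: mF.
Qed.

Lemma ge0_integral_label (R : realType) (mu : {measure set (label K) -> \bar R})
    (F : label K -> \bar R) : (forall y, 0 <= F y)%E ->
  (\int[mu]_y F y = \sum_y F y * mu [set y])%E.
Proof.
move=> F0.
have FE z : F z = (\sum_y F y * (\1_[set y] z)%:E)%E.
  rewrite (bigD1 z)//= big1 ?adde0 => [|y yz].
    by rewrite indicE mem_set// mule1.
  by rewrite indicE memNset ?mule0//= => /esym/eqP; exact/negP.
under eq_integral do rewrite FE.
rewrite ge0_integral_sum//; last by move=> y x _; rewrite mule_ge0.
apply: eq_bigr => y _; rewrite ge0_integralZl//.
by rewrite integral_indic// setIT.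
Qed.

End label_measurability.

(** * Predictors and pointwise properties of the cross-entropy *)

Section cross_entropy.
Context {R : realType} {K : nat}.
Local Open Scope ereal_scope.

Lemma predictor_le1 d (T : measurableType d) (h : T -> label K -> R) x y :
  predictor T h -> (h x y <= 1)%R.
Proof.
move=> [_ h0 h1]; rewrite -(h1 x) (bigD1 y)//= lerDl.
by apply: sumr_ge0 => z _; exact: h0.
Qed.

Lemma cross_entropy_ge0 (q : label K -> R) y : (q y <= 1)%R ->
  0 <= cross_entropy q y.
Proof. by move=> q1; rewrite /cross_entropy oppe_ge0 lne_le0 lee_fin. Qed.

Lemma cross_entropy_EFin (q : label K -> R) y : (0 < q y)%R ->
  cross_entropy q y = (- ln (q y))%:E.
Proof. by move=> q0; rewrite /cross_entropy lne_EFin. Qed.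

Lemma measurable_lne_EFin d (T : measurableType d) (u : T -> R) :
  measurable_fun [set: T] u -> measurable_fun [set: T] (fun x => lne (u x)%:E).
Proof.
move=> mu; rewrite /lne; apply: measurable_fun_ifT => //=.
  exact: measurable_fun_ler.
by apply/measurable_EFinP; apply: measurableT_comp => //; exact: measurable_ln.
Qed.

Lemma measurable_predictor d (T : measurableType d) (h : T -> label K -> R) :
  predictor T h ->
  measurable_fun [set: T * label K] (fun w => h w.1 w.2).
Proof. by move=> [mh _ _]; exact: measurable_fun_label. Qed.

Lemma measurable_cross_entropy d (T : measurableType d) (h : T -> label K -> R) :
  predictor T h ->
  measurable_fun [set: T * label K] (fun w => cross_entropy (h w.1) w.2).
Proof.
by move=> /measurable_predictor mh; apply: measurableT_comp => //;
  exact: measurable_lne_EFin.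
Qed.

Lemma expected_CE_ge0 d (T : measurableType d)
    (p : probability (T * label K)%type R) (h : T -> label K -> R) :
  predictor T h -> 0 <= expected_CE p h.
Proof.
by move=> hh; apply: integral_ge0 => w _; exact/cross_entropy_ge0/predictor_le1.
Qed.

Lemma predictor_cst d (T : measurableType d) (q : label K -> R) :
  (forall y, 0 <= q y)%R -> (\sum_y q y = 1)%R -> predictor T (fun=> q).
Proof. by move=> q0 q1; split. Qed.

(* The inequality [ln t <= t - 1] at [t = h y / q y], written without
   subtraction so that it survives [h y = 0], where the right side is [+oo]. *)
Lemma cross_entropy_tangent (q h : label K -> R) y : (0 < q y)%R -> (0 <= h y)%R ->
  cross_entropy q y + 1 <= cross_entropy h y + (h y / q y)%:E.
Proof.
move=> q0; rewrite le_eqVlt => /predU1P[h0|h0].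
  by rewrite {2}/cross_entropy -h0 le0_lneNy//= addye ?leey.
rewrite !cross_entropy_EFin// -!EFinD lee_fin.
have := @le_ln1Dx R (h y / q y - 1)%R.
rewrite ltrBrDr addrC subrr divr_gt0// => /(_ isT).
rewrite [(1 + _)%R]addrC subrK ln_div ?posrE// => le_ln.
by rewrite -subr_ge0; move: le_ln; rewrite -subr_ge0; congr (0 <= _)%R; ring.
Qed.

End cross_entropy.

(** * Disintegration of one joint law into its input marginal and a posterior *)

Section posterior.
Context {R : realType} {K : nat} {d} {X : measurableType d}.
Variable p : probability (X * label K)%type R.
Local Open Scope ereal_scope.

Definition label_mass (y : label K) : R := fine (p (snd @^-1` [set y])).

Let product : probability (X * label K)%type R :=
  distribution p fst \x distribution p snd.

Lemma label_massE y : distribution p snd [set y] = (label_mass y)%:E.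
Proof.
rewrite /label_mass fineK//; apply: fin_num_measure.
by rewrite -[X in measurable X]setTI; exact: measurable_snd.
Qed.

Lemma label_mass_ge0 y : (0 <= label_mass y)%R.
Proof. exact/fine_ge0/measure_ge0. Qed.

Lemma sum_label_mass : (\sum_y label_mass y = 1)%R.
Proof.
apply: EFin_inj; rewrite -sumEFin.
rewrite -(@probability_setT _ _ _ (distribution p snd)) -[RHS]mul1e -integral_cst// ge0_integral_label//.
by apply: eq_bigr => y _; rewrite mul1e; exact/esym/label_massE.
Qed.

(** A set that is null for the product splits into finitely many one-label rectangles [S y]. The
    product measure of each is a product of two marginal masses, so one factor vanishes, and [S y]
    lies in the corresponding [p]-null cylinder. *)
Lemma joint_dominates : p `<< product.
Proof.
apply/null_content_dominatesP => A mA QA0.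
pose S y := (ysection A y `*` [set y])%classic.
have mS y : measurable (S y) by apply: measurableX => //; exact: measurable_ysection.
have SA y : S y `<=` A by move=> [x z] [/= xA ->]; move: xA; rewrite /ysection/= inE.
have QS0 y : product (S y) = 0.
  by apply: (subset_measure0 _ _ (SA y)) => //.
have pS0 y : p.-negligible (S y).
  exists (S y); split => //.
  have : distribution p fst (ysection A y) * distribution p snd [set y] = 0.
    by rewrite -product_measure1E//; [exact: QS0|exact: measurable_ysection].
  move/eqP; rewrite mule_eq0 => /orP[]/eqP h0.
    have {}h0 : p (fst @^-1` ysection A y) = 0 := h0.
    apply: subset_measure0 h0 => //; last by move=> [x z] [].
    by rewrite -[X in measurable X]setTI; apply: measurable_fst => //;
      exact: measurable_ysection.
  have {}h0 : p (snd @^-1` [set y]) = 0 := h0.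
  apply: subset_measure0 h0 => //; last by move=> [x z] [].
  by rewrite -[X in measurable X]setTI; exact: measurable_snd.
have AS : A `<=` \big[setU/set0]_(y : label K) S y.
  move=> [x y] Axy; rewrite -bigcup_seq/=; exists y => /=.
    by rewrite mem_index_enum.
  by split => //=; rewrite /ysection/= inE.
suff : p.-negligible A by move/negligibleP => /(_ mA).
apply: negligibleS AS _.
by apply: big_ind => [|B C|y _]; [exact: negligible_set0|exact: negligibleU|exact: pS0].
Qed.

(** The density of [p] with respect to the input marginal times counting measure on labels: a
    version of the conditional law of the label, normalised only almost everywhere. *)
Definition joint_density (x : X) (y : label K) : R :=
  label_mass y * fine (Radon_Nikodym_SigmaFinite.f p product (x, y)).

Lemma joint_density_ge0 x y : (0 <= joint_density x y)%R.
Proof.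
apply: mulr_ge0; first exact: label_mass_ge0.
exact/fine_ge0/Radon_Nikodym_SigmaFinite.f_ge0/joint_dominates.
Qed.

Let measurable_density :
  measurable_fun [set: X * label K] (Radon_Nikodym_SigmaFinite.f p product).
Proof.
exact: measurable_int (Radon_Nikodym_SigmaFinite.f_integrable joint_dominates).
Qed.

Lemma measurable_joint_density y :
  measurable_fun [set: X] (joint_density ^~ y).
Proof.
apply: measurable_funM => //; apply: measurableT_comp => //.
exact: (measurableT_comp measurable_density).
Qed.

(** Change of variables by the Radon-Nikodym derivative, then Tonelli; the inner integral is a
    finite sum whose weights [label_mass] are absorbed into [joint_density]. *)
Lemma ge0_integral_joint_density (F : X * label K -> \bar R) :
  measurable_fun [set: X * label K] F -> (forall w, 0 <= F w) ->
  \int[p]_w F w =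
  \int[distribution p fst]_x \sum_y F (x, y) * (joint_density x y)%:E.
Proof.
move=> mF F0.
have r0 := Radon_Nikodym_SigmaFinite.f_ge0 joint_dominates.
rewrite -(Radon_Nikodym_SigmaFinite.change_of_variables joint_dominates)//.
rewrite fubini_tonelli1; last 2 first.
- exact: emeasurable_funM.
- by move=> w; exact: mule_ge0.
apply: eq_integral => x _; rewrite /fubini_F ge0_integral_label; last first.
  by move=> y; exact: mule_ge0.
apply: eq_bigr => y _; rewrite -muleA; congr (_ * _).
rewrite /joint_density EFinM muleC; congr (_ * _); first exact: label_massE.
by rewrite fineK//; exact: (Radon_Nikodym_SigmaFinite.f_fin_num joint_dominates).
Qed.

Lemma sum_joint_density :
  {ae distribution p fst, forall x, (\sum_y joint_density x y = 1)%R}.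
Proof.
have : ae_eq (distribution p fst) setT (cst 1)
    (fun x => \sum_y (joint_density x y)%:E).
  apply: integral_ae_eq => //.
  - exact: finite_measure_integrable_cst.
  - apply: emeasurable_sum => y; apply/measurable_EFinP.
    exact: measurable_joint_density.
  - move=> E _ mE; rewrite integral_cst// mul1e.
    have mE1 : measurable (fst @^-1` E : set (X * label K)).
      by rewrite -[X in measurable X]setTI; exact: measurable_fst.
    transitivity (\int[p]_w (\1_E w.1)%:E).
      by rewrite (_ : (fun w => _) = EFin \o \1_(fst @^-1` E))// integral_indic// setIT.
    rewrite ge0_integral_joint_density//; last first.
      apply/measurable_EFinP; apply: measurableT_comp => //.
    rewrite [RHS]integral_mkcond; apply: eq_integral => x _.
    rewrite epatch_indic /= ge0_sume_distrl; last first.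
      by move=> y _; rewrite lee_fin joint_density_ge0.
    by apply: eq_bigr => y _; rewrite muleC.
by apply: filterS => x /(_ I)/=; rewrite sumEFin => -[<-].
Qed.

(* The default value makes it a predictor at every input, not just almost
   every one. *)
Definition posterior (x : X) (y : label K) : R :=
  if (\sum_z joint_density x z == 1)%R then joint_density x y else (K.+1%:R^-1)%R.

Lemma predictor_posterior : predictor X posterior.
Proof.
split => [y|x y|x]; rewrite /posterior.
- apply: measurable_fun_ifT => //; last exact: measurable_joint_density.
  apply: measurable_fun_eqr => //.
  by apply: measurable_sum => z; exact: measurable_joint_density.
- by case: ifP => _; [exact: joint_density_ge0|rewrite invr_ge0].
- case: eqP => [//|_].
  by rewrite sumr_const card_ord -[LHS]mulr_natr mulVf// pnatr_eq0.
Qed.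

Lemma ge0_integral_posterior (F : X * label K -> \bar R) :
  measurable_fun [set: X * label K] F -> (forall w, 0 <= F w) ->
  \int[p]_w F w =
  \int[distribution p fst]_x \sum_y F (x, y) * (posterior x y)%:E.
Proof.
move=> mF F0; rewrite ge0_integral_joint_density//.
have [mpost post0 _] := predictor_posterior.
apply: ge0_ae_eq_integral => //.
- apply: emeasurable_sum => y; apply: emeasurable_funM.
    exact: measurable_fun_pair1.
  exact/measurable_EFinP/measurable_joint_density.
- apply: emeasurable_sum => y; apply: emeasurable_funM.
    exact: measurable_fun_pair1.
  exact/measurable_EFinP/mpost.
- by move=> x _; apply: sume_ge0 => y _; rewrite mule_ge0// lee_fin joint_density_ge0.
- by move=> x _; apply: sume_ge0 => y _; rewrite mule_ge0// lee_fin post0.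
- apply: filterS sum_joint_density => x sum1 _.
  by apply: eq_bigr => y _; rewrite /posterior sum1 eqxx.
Qed.

(** Where the posterior vanishes, the disintegration gives weight zero. This makes the logarithms of
    the posterior finite almost everywhere. *)
Lemma posterior_gt0 : {ae p, forall w, (0 < posterior w.1 w.2)%R}.
Proof.
have [mpost post0 _] := predictor_posterior.
pose A := [set w | posterior w.1 w.2 = 0%R] : set (X * label K).
have mA : measurable A.
  rewrite -[A]setTI.
  exact: (measurable_predictor predictor_posterior) measurableT _ (measurable_set1 0%R).
exists A; split => //; last first.
  move=> w/= /negP; rewrite -leNgt => post_le0.
  by apply/eqP; rewrite eq_le post_le0 post0.
rewrite -[A]setIT -integral_indic// ge0_integral_posterior//; last first.
  exact/measurable_EFinP/measurable_indic.
apply: integral0_eq => x _; apply: big1 => y _.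
rewrite indicE; have [/set_mem/= ->|] := boolP ((x, y) \in A).
  by rewrite mule0.
by rewrite mul0e.
Qed.

Lemma posterior_joint_density :
  {ae p, forall w, posterior w.1 w.2 = joint_density w.1 w.2}.
Proof.
have [N [mN N0 subN]] := sum_joint_density.
exists (fst @^-1` N); split => //.
  by rewrite -[X in measurable X]setTI; exact: measurable_fst.
move=> w neq; apply: subN => /= sum1; apply: neq.
by rewrite /= /posterior sum1 eqxx.
Qed.

Lemma label_mass_gt0 : {ae p, forall w, (0 < label_mass w.2)%R}.
Proof.
apply: filterS2 posterior_joint_density posterior_gt0 => w -> joint_gt0.
rewrite lt_neqAle label_mass_ge0 andbT; apply: contraTneq joint_gt0 => mass0.
rewrite /joint_density -mass0.
by rewrite mul0r ltxx.
Qed.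

Lemma Radon_Nikodym_posterior :
  {ae p, forall w, Radon_Nikodym (charge_of_finite_measure p) product w =
    (posterior w.1 w.2 / label_mass w.2)%:E}.
Proof.
(* The nonnegative derivative behind [joint_density] and the charge derivative in [KL_divergence]
   agree almost everywhere for the product, hence for [p] by domination. *)
have aeE : ae_eq p setT (Radon_Nikodym_SigmaFinite.f p product)
    (Radon_Nikodym (charge_of_finite_measure p) product).
  apply: null_dominates_ae_eq joint_dominates _ => //.
  exact/ae_eq_Radon_Nikodym_SigmaFinite/measurableT/joint_dominates.
apply: filterS3 aeE posterior_joint_density label_mass_gt0.
move=> -[x y] /(_ I) <- /= -> mass_gt0.
rewrite /joint_density mulrAC divff ?gt_eqF// mul1r fineK//.
exact: (Radon_Nikodym_SigmaFinite.f_fin_num joint_dominates).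
Qed.

(** Integrating [cross_entropy_tangent] bounds the posterior risk plus 1 by the risk of [h] plus the
    integral of [h / posterior], which is at most 1. The risk of [h] may be [+oo], so only the
    finite 1 is cancelled. *)
Lemma expected_CE_posterior_le (h : X -> label K -> R) : predictor X h ->
  expected_CE p posterior <= expected_CE p h.
Proof.
move=> hh; have hpost := predictor_posterior.
have [_ h0 h1] := hh; have [_ post0 _] := hpost.
(* The ratio h / posterior, written so that its measurability is that of
   expR and ln. *)
pose ratio (w : X * label K) : \bar R :=
  (h w.1 w.2 * expR (- ln (posterior w.1 w.2)))%:E.
have mratio : measurable_fun [set: X * label K] ratio.
  apply/measurable_EFinP; apply: measurable_funM.
    exact: measurable_predictor.
  apply: measurableT_comp => //; apply: measurable_funN.
  apply: measurableT_comp; first exact: measurable_ln.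
  exact: measurable_predictor.
have ratio0 w : 0 <= ratio w by rewrite lee_fin mulr_ge0// expR_ge0.
(* The posterior cancels against the disintegration weight and leaves the sum of [h x y]. Labels of
   posterior zero contribute 0 instead of [h x y], whence only an inequality. *)
have ratio1 : \int[p]_w ratio w <= 1.
  rewrite ge0_integral_posterior//.
  rewrite -(@probability_setT _ _ _ (distribution p fst)) -[leRHS]mul1e.
  rewrite -integral_cst//; apply: ge0_le_integral => //.
  - by move=> x _; apply: sume_ge0 => y _; rewrite mule_ge0// lee_fin.
  - apply: emeasurable_sum => y; apply: emeasurable_funM.
      exact: measurable_fun_pair1.
    by apply/measurable_EFinP; have [] := hpost.
  - move=> x _; rewrite -(h1 x) -sumEFin; apply: lee_sum => y _.
    rewrite -EFinM lee_fin -mulrA ler_piMr//.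
    have := post0 x y; rewrite le_eqVlt => /predU1P[<-|post_gt0].
      by rewrite mulr0.
    by rewrite expRN lnK ?posrE// mulVf// gt_eqF.
have post_ge0 w : 0 <= cross_entropy (posterior w.1) w.2.
  exact/cross_entropy_ge0/predictor_le1.
have h_ge0 w : 0 <= cross_entropy (h w.1) w.2.
  exact/cross_entropy_ge0/predictor_le1.
rewrite -(@leeD2rE _ 1)//; apply: (@le_trans _ _ (expected_CE p h + \int[p]_w ratio w)).
  rewrite -[X in _ + X <= _]mul1e -[X in _ * X](@probability_setT _ _ _ p).
  rewrite -integral_cst// -!ge0_integralD//;
    [|exact: measurable_cross_entropy..].
  apply: ae_ge0_le_integral => //.
  - by move=> w _; rewrite adde_ge0.
  - by apply: emeasurable_funD => //; exact: measurable_cross_entropy.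
  - by move=> w _; rewrite adde_ge0.
  - by apply: emeasurable_funD => //; exact: measurable_cross_entropy.
  - apply: filterS posterior_gt0 => w post_gt0 _.
    rewrite /ratio expRN lnK ?posrE//; exact: cross_entropy_tangent.
by rewrite leeD2l.
Qed.

(** * Label entropy and mutual information *)

Lemma predictor_label_mass : predictor X (fun=> label_mass).
Proof. exact: predictor_cst label_mass_ge0 sum_label_mass. Qed.

Lemma expected_CE_label_mass_lty : expected_CE p (fun=> label_mass) < +oo.
Proof.
(* Almost surely the label has positive mass, and its cross-entropy is then one of the finitely many
   summands of [C], up to sign. *)
pose C : R := (\sum_y `|ln (label_mass y)|)%R.
have C0 : (0 <= C)%R by apply: sumr_ge0.
apply: (@le_lt_trans _ _ (\int[p]_w C%:E)); last first.
  rewrite integral_cst//; apply: lte_mul_pinfty => //.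
  exact: le_lt_trans (probability_le1 _ _) (ltry _).
rewrite /expected_CE; apply: ae_ge0_le_integral => //.
- move=> w _; apply: cross_entropy_ge0.
  exact: (predictor_le1 w.1 w.2 predictor_label_mass).
- exact: measurable_cross_entropy predictor_label_mass.
- apply: filterS label_mass_gt0 => w mass_gt0 _.
  rewrite cross_entropy_EFin// lee_fin (le_trans (ler_norm _))// normrN.
  by rewrite /C (bigD1 w.2)//= lerDl sumr_ge0.
Qed.

Lemma expected_CE_posterior_lty : expected_CE p posterior < +oo.
Proof.
apply: le_lt_trans (expected_CE_posterior_le predictor_label_mass) _.
exact: expected_CE_label_mass_lty.
Qed.

Lemma mutual_informationE : mutual_information p =
  expected_CE p (fun=> label_mass) - expected_CE p posterior.
Proof.
have hpost := predictor_posterior; have hmass := predictor_label_mass.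
have integrable_CE (h : X -> label K -> R) : predictor X h ->
    expected_CE p h < +oo ->
    p.-integrable setT (fun w => cross_entropy (h w.1) w.2).
  move=> hh h_fin; apply/integrableP; split; first exact: measurable_cross_entropy.
  under eq_integral do
    (rewrite gee0_abs; last exact/cross_entropy_ge0/predictor_le1).
  by [].
rewrite /mutual_information /KL_divergence asboolT; last exact: joint_dominates.
rewrite /expected_CE -integralB//; last 2 first.
- exact: integrable_CE expected_CE_label_mass_lty.
- exact: integrable_CE expected_CE_posterior_lty.
apply: ae_eq_integral => //.
- set RN := Radon_Nikodym _ _.
  (* The derivative is finite everywhere, so its logarithm is that of a real function and
     [measurable_lne_EFin] applies. *)
  have -> : (fun w => lne (RN w)) = (fun w => lne (fine (RN w))%:E).
    apply/funext => w; rewrite fineK//.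
    exact/Radon_Nikodym_fin_num/joint_dominates.
  apply: measurable_lne_EFin; apply: measurableT_comp => //.
  apply: (measurable_int product).
  exact/Radon_Nikodym_integrable/joint_dominates.
- apply: emeasurable_funB; first exact: (measurable_cross_entropy hmass).
  exact: (measurable_cross_entropy hpost).
- apply: filterS3 Radon_Nikodym_posterior posterior_gt0 label_mass_gt0.
  move=> w RNE post_gt0 mass_gt0 _; rewrite RNE.
  rewrite lne_EFin ?divr_gt0// ln_div ?posrE// !cross_entropy_EFin//.
  by rewrite -EFinB opprK addrC.
Qed.

End posterior.

(** * Transfer between domains and the final inequality *)

Lemma expected_CE_comp (R : realType) (K : nat) (dX dZ : measure_display)
    (X : measurableType dX) (Z : measurableType dZ)
    (p q : probability (X * label K)%type R) (f : X -> Z)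
    (g : Z -> label K -> R) :
  measurable_fun [set: X] f -> predictor Z g ->
  (forall B : set (Z * label K), measurable B ->
     pushforward p (fun w => (f w.1, w.2)) B =
     pushforward q (fun w => (f w.1, w.2)) B) ->
  expected_CE p (g \o f) = expected_CE q (g \o f).
Proof.
move=> mf hg pq; rewrite /expected_CE.
pose phi (w : X * label K) := (f w.1, w.2).
have mphi : measurable_fun setT phi.
  apply: measurable_fun_pair; last exact: measurable_snd.
  exact: measurableT_comp mf measurable_fst.
(* The risk of [g \o f] is an integral against the law of the pair of feature and label, so it
   depends on nothing else. *)
have pushE (r : probability (X * label K)%type R) :
    (\int[r]_w cross_entropy ((g \o f) w.1) w.2 =
     \int[pushforward r phi]_w cross_entropy (g w.1) w.2)%E.
  rewrite ge0_integral_pushforward//; first exact: measurable_cross_entropy.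
  by move=> w _; exact/cross_entropy_ge0/predictor_le1.
rewrite !pushE; apply: eq_measure_integral => B mB _; exact: pq.
Qed.

Lemma predictor_comp (R : realType) (K : nat) (dX dZ : measure_display)
    (X : measurableType dX) (Z : measurableType dZ) (f : X -> Z)
    (g : Z -> label K -> R) :
  measurable_fun [set: X] f -> predictor Z g -> predictor X (g \o f).
Proof.
move=> mf [mg g0 g1]; split => [y|x y|x]; [|exact: g0|exact: g1].
exact: (measurableT_comp (mg y) mf).
Qed.

Theorem theorem1 (R : realType) (M K : nat) (hM : (0 < M)%N)
    (dX dZ : measure_display) (X : measurableType dX) (Z : measurableType dZ)
    (p : 'I_M -> probability (X * label K)%type R)
    (p_distinct : forall i j : 'I_M, i != j ->
       exists2 A, measurable A & p i A <> p j A)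
    (f : X -> Z) (mf : measurable_fun [set: X] f)
    (f_invariant : forall (i j : 'I_M) (B : set (Z * label K)), measurable B ->
       pushforward (p i) (fun w => (f w.1, w.2)) B =
       pushforward (p j) (fun w => (f w.1, w.2)) B)
    (m : 'I_M)
    (m_min : forall i : 'I_M,
       (mutual_information (p m) <= mutual_information (p i))%E) :
  (information_gap p m <= optimal_feature_CE p f - optimal_input_CE p)%E.
Proof.
have mass_inv i : label_mass (p i) = label_mass (p m).
  apply/funext => y; rewrite /label_mass; congr fine.
  have := f_invariant i m (snd @^-1` [set y]).
  apply; rewrite -[X in measurable X]setTI; exact: measurable_snd.
pose q := label_mass (p m).
have hq d (T : measurableType d) : predictor T (fun=> q).
  exact: predictor_cst (label_mass_ge0 _) (sum_label_mass _).
(* A constant predictor factors through [f], so feature invariance also equates the label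
   entropies. *)
have entropy_inv i : expected_CE (p i) (fun=> q) = expected_CE (p m) (fun=> q).
  exact: (expected_CE_comp mf (hq _ Z) (f_invariant i m)).
have H_fin : expected_CE (p m) (fun=> q) \is a fin_num.
  rewrite ge0_fin_numE; last exact: expected_CE_ge0.
  exact: expected_CE_label_mass_lty.
have risk_fin i : expected_CE (p i) (posterior (p i)) \is a fin_num.
  rewrite ge0_fin_numE; last exact/expected_CE_ge0/predictor_posterior.
  exact: expected_CE_posterior_lty.
pose c i := fine (expected_CE (p i) (posterior (p i))).
have cE i : expected_CE (p i) (posterior (p i)) = (c i)%:E by rewrite fineK.
(* With [c i] the conditional entropy of domain [i], the common label entropy cancels in each
   difference; the term [i = m] is zero and completes the sum. *)
have gapE : information_gap p m = (\sum_(i < M) (c m - c i))%:E.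
  rewrite (bigD1 m)//= subrr add0r -sumEFin; apply: eq_bigr => i _.
  rewrite !mutual_informationE mass_inv entropy_inv !cE -(fineK H_fin).
  by rewrite -!EFinB; congr EFin; ring.
(* Each domain's risk of [g \o f] is moved to domain [m], where the posterior does at least as
   well. *)
have feature_ge : ((\sum_(i < M) c m)%:E <= optimal_feature_CE p f)%E.
  apply: le_ereal_inf_tmp => _ [g hg <-]; rewrite -sumEFin; apply: lee_sum => i _.
  rewrite (expected_CE_comp mf hg (f_invariant i m)) -cE.
  exact/expected_CE_posterior_le/predictor_comp.
(* The predictor may vary with the domain, so the family of posteriors is admissible. *)
have input_le : (optimal_input_CE p <= (\sum_(i < M) c i)%:E)%E.
  apply: ereal_inf_lbound; exists (fun i => posterior (p i)).
    by move=> i /=; rewrite inE; exact: predictor_posterior.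
  by rewrite -sumEFin; apply: eq_bigr => i _; exact: cE.
by rewrite gapE sumrB EFinB; exact: leeB.
Qed.
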